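(* Let $n$ be a positive integer. Then the following are equivalent: (i) $\frac{1}{n}+\sum_{p \mid n}\frac{1}{p} \in \mathbb{N}$. (ii) $\sum_{p\mid n}\frac{n}{p}+1\equiv 0\pmod{n}$. (iii) $n B_{\phi(n)}\equiv 1 \pmod{n}$. (iv) $\sum_{i=1}^{n-1} i^{\phi(n)} \equiv 1 \pmod n$. (v) $p \mid (n/p+1)$ for every prime divisor $p$ of $n$. (vi) $n'=an-1$ for some $a \in \mathbb{N}$.
   Context: Sums indexed by $p\mid n$ run over the distinct prime divisors $p$ of $n$ (empty sums are $0$). $\mathbb{N}=\{1,2,3,\dots\}$. $\phi$ is Euler's totient function and $B_k$ denotes the $k$-th Bernoulli number (either sign convention for $B_1=\pm\frac12$ may be used). For rational numbers $r_1,r_2$, the statement $r_1\equiv r_2\pmod n$ means that $n$ divides the numerator (in lowest terms) of $r_1-r_2$. The arithmetic derivative of a positive integer $n$ is $n'=n\sum_{p\mid n}\frac{\nu_p(n)}{p}$, where $\nu_p(n)=\max\{s: p^s\mid n\}$. *)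

(* Defs.v *)
From mathcomp Require Import all_boot all_order all_algebra.

Set Implicit Arguments.
Unset Strict Implicit.
Unset Printing Implicit Defensive.

Import Order.TTheory GRing.Theory Num.Theory.

Local Open Scope ring_scope.

(* The list B_0, ..., B_(k-1), computed from
     B_m = [m = 0] - (m + 1)^-1 * \sum_(j < m) 'C(m + 1, j) * B_j,
   so that B_1 = - 1/2; see bernoulli_rec and bernoulli1 below. *)
Fixpoint bernoulli_seq (k : nat) : seq rat :=
  if k is m.+1 then
    let s := bernoulli_seq m in
    rcons s ((m == 0%N)%:R
             - (m.+1)%:R^-1 * \sum_(j < m) 'C(m.+1, j)%:R * nth 0 s j)
  else [::].

Definition bernoulli_minus (k : nat) : rat := nth 0 (bernoulli_seq k.+1) k.

Definition bernoulli_plus (k : nat) : rat := (-1) ^+ k * bernoulli_minus k.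

(* B is the sequence of Bernoulli numbers, for one of the two usual sign
   conventions B_1 = - 1/2 or B_1 = 1/2. *)
Definition is_bernoulli (B : nat -> rat) : Prop :=
  B =1 bernoulli_minus \/ B =1 bernoulli_plus.

(* n divides the numerator, in lowest terms, of r1 - r2. *)
Definition rat_congr (n : nat) (r1 r2 : rat) : Prop :=
  (n%:Z %| numq (r1 - r2))%Z.

Definition arith_deriv (n : nat) : rat :=
  n%:R * \sum_(p <- primes n) (logn p n)%:R / p%:R.

Lemma size_bernoulli_seq k : size (bernoulli_seq k) = k.
Proof. by elim: k => //= k IHk; rewrite size_rcons IHk. Qed.

Lemma nth_bernoulli_seq k j :
  (j < k)%N -> nth 0 (bernoulli_seq k) j = bernoulli_minus j.
Proof.
elim: k => // k IHk; rewrite ltnS leq_eqVlt => /predU1P[-> // | lt_jk].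
by rewrite /= nth_rcons size_bernoulli_seq lt_jk IHk.
Qed.

Lemma bernoulli_rec k :
  \sum_(j < k.+1) 'C(k.+1, j)%:R * bernoulli_minus j = (k == 0%N)%:R.
Proof.
rewrite big_ord_recr /= binSn {2}/bernoulli_minus /= nth_rcons.
rewrite size_bernoulli_seq ltnn eqxx mulrBr mulVKf ?pnatr_eq0 //.
under [in X in _ - X]eq_bigr => j _ do rewrite nth_bernoulli_seq //.
by rewrite addrC subrK; case: k => [|k]; rewrite ?mulr1 ?mulr0.
Qed.

Lemma bernoulli1 : bernoulli_minus 1 = - 2^-1 /\ bernoulli_plus 1 = 2^-1.
Proof.
have B0 : bernoulli_minus 0 = 1 by have := bernoulli_rec 0; rewrite big_ord1 mul1r.
have B1 : bernoulli_minus 1 = - 2^-1.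
  have := bernoulli_rec 1; rewrite big_ord_recr big_ord1 /= B0 bin0 bin1 mulr1.
  by move/eqP; rewrite addrC addr_eq0 => /eqP E; rewrite -[LHS](mulKf (x := 2)) ?E ?mulrN1.
by rewrite /bernoulli_plus B1 mulN1r opprK.
Qed.

(* Main.v *)
(* Condition (v) forces n to be squarefree: p | n/p + 1 excludes p | n/p. For a
   prime p | n, every term n/q with q != p vanishes modulo p, and by Fermat
   \sum_i i^phi(n) = - n/p modulo p, because (p - 1) | phi(n); so (i), (ii),
   (iv), (v) and (vi) are all decided prime by prime. For (iii), Faulhaber's formula gives
     \sum_(i < n) i^k = n B_k + \sum_(j < k) 'C(k, j) B_j n^(k+1-j) / (k+1-j),
   and for even k > 0 each term of the last sum lies in n Z_(n), where Z_(n) is the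
   localization of Z at the primes dividing n; this only needs n B_j in Z_(n), a
   weak form of the von Staudt-Clausen theorem, so (iii) is equivalent to (iv). *)
Require Import Defs.
From mathcomp Require Import all_boot all_order all_algebra.
From mathcomp Require Import ring zify.

Set Implicit Arguments.
Unset Strict Implicit.
Unset Printing Implicit Defensive.

Import Order.TTheory GRing.Theory Num.Theory.
Local Open Scope ring_scope.

Lemma mem_primes_gt0 n p : (0 < n)%N ->
  (p \in primes n) = prime p && (p %| n)%N.
Proof. by move=> n_gt0; rewrite mem_primes n_gt0. Qed.

(** * Bernoulli polynomials and Faulhaber's formula *)

Lemma ffactnD n k l : (n ^_ (k + l) = n ^_ k * (n - k) ^_ l)%N.
Proof.
elim: l => [|l IHl]; first by rewrite addn0 muln1.
by rewrite addnS !ffactnSr IHl subnDA mulnA.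
Qed.

(** Multiplied by i! j!, both sides become the falling factorial [K ^_ (i + j)], even when i + j >
    K. *)
Lemma bin_mul_swap K i j :
  ('C(K, j) * 'C(K - j, i) = 'C(K, i) * 'C(K - i, j))%N.
Proof.
have bin_ffactM m k l : ('C(m, k) * 'C(m - k, l) * (k`! * l`!) = m ^_ (k + l))%N.
  by rewrite ffactnD -!bin_ffact; ring.
apply/eqP; rewrite -(eqn_pmul2r (_ : 0 < j`! * i`!)%N) ?muln_gt0 ?fact_gt0 //.
by rewrite bin_ffactM [X in (_ * X)%N]mulnC bin_ffactM addnC.
Qed.

(** The sum is the value B_M(1) of the Bernoulli polynomial; by the recurrence it differs from
    B_M(0) only at M = 1. *)
Lemma sum_bin_bernoulli M :
  \sum_(j < M.+1) 'C(M, j)%:R * bernoulli_minus j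
  = bernoulli_minus M + (M == 1)%:R.
Proof.
rewrite big_ord_recr /= binn mul1r addrC; congr (_ + _).
by case: M => [|M]; [rewrite big_ord0 | rewrite bernoulli_rec].
Qed.

Definition bernoulli_poly K (x : rat) :=
  \sum_(j < K.+1) 'C(K, j)%:R * bernoulli_minus j * x ^+ (K - j).

Lemma bernoulli_polyE K x :
  bernoulli_poly K x = \sum_(i < K.+1) 'C(K, i)%:R * bernoulli_minus (K - i) * x ^+ i.
Proof.
rewrite /bernoulli_poly (reindex_inj rev_ord_inj) /=.
apply: eq_bigr => i _; have le_iK : (i <= K)%N by rewrite -ltnS.
by rewrite subSS bin_sub // subKn.
Qed.

(** Expanding (x + 1)^(K+1-j) and exchanging sums turns the coefficient of x^i into C(K+1, i)
    B_(K+1-i)(1), which differs from that of B_(K+1)(x) only at i = K. *)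
Lemma bernoulli_polyS K x :
  bernoulli_poly K.+1 (x + 1) - bernoulli_poly K.+1 x = K.+1%:R * x ^+ K.
Proof.
(* Binomials beyond M vanish, so all inner sums can run over one common range and be exchanged. *)
have widen M (F : nat -> rat) : (M <= K.+1)%N -> \sum_(i < M.+1) 'C(M, i)%:R * F i
    = \sum_(i < K.+2) 'C(M, i)%:R * F i.
  move=> le_MK; rewrite (big_ord_widen K.+2 (fun i => 'C(M, i)%:R * F i)) //.
  rewrite big_mkcond /=; apply: eq_bigr => i _; case: ltnP => // lt_Mi.
  by rewrite bin_small ?mul0r.
have -> : bernoulli_poly K.+1 (x + 1) = \sum_(i < K.+2) 'C(K.+1, i)%:R *
    (bernoulli_minus (K.+1 - i) + (K.+1 - i == 1)%N%:R) * x ^+ i.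
  transitivity (\sum_(j < K.+2) \sum_(i < K.+2)
      ('C(K.+1, j) * 'C(K.+1 - j, i))%:R * bernoulli_minus j * x ^+ i).
    apply: eq_bigr => j _; rewrite exprD1n.
    under eq_bigr => i _ do rewrite -mulr_natl.
    rewrite (widen _ (fun i => x ^+ i)) ?leq_subr // mulr_sumr.
    by apply: eq_bigr => i _; rewrite natrM; ring.
  rewrite exchange_big /=; apply: eq_bigr => i _.
  rewrite -sum_bin_bernoulli widen ?leq_subr // mulr_sumr mulr_suml.
  by apply: eq_bigr => j _; rewrite bin_mul_swap natrM; ring.
rewrite bernoulli_polyE -sumrB.
under eq_bigr => i _ do rewrite -mulrBl -mulrBr addrC addKr.
rewrite !big_ord_recr /= subnn mulr0 mul0r addr0 subSnn eqxx mulr1 binSn.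
rewrite big1 ?add0r // => i _.
have -> : (K.+1 - i == 1)%N = false by have := ltn_ord i; lia.
by rewrite mulr0 mul0r.
Qed.

(** [bernoulli_polyS] telescopes; (k+1-j) C(k+1, j) = (k+1) C(k, j) then removes the factor k+1. *)
Lemma sum_powers_bernoulli k n :
  \sum_(0 <= i < n) i%:R ^+ k
  = \sum_(j < k.+1) 'C(k, j)%:R * bernoulli_minus j
                     * (n%:R ^+ (k.+1 - j) / (k.+1 - j)%:R) :> rat.
Proof.
apply: (mulfI (x := k.+1%:R)); first by rewrite pnatr_eq0.
have -> : k.+1%:R * \sum_(0 <= i < n) i%:R ^+ k
    = bernoulli_poly k.+1 n%:R - bernoulli_poly k.+1 0.
  rewrite mulr_sumr; apply: (telescope_sumr_eq (fun i => bernoulli_poly k.+1 i%:R)) => // i _.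
  by rewrite -bernoulli_polyS -natr1.
rewrite /bernoulli_poly -sumrB big_ord_recr /= subnn subrr addr0 mulr_sumr.
apply: eq_bigr => j _; have le_jk : (j <= k)%N by rewrite -ltnS.
rewrite expr0n subn_eq0 leqNgt ltn_ord mulr0 subr0.
have /(congr1 (fun m => m%:R : rat)) := mul_bin_down k.+1 j; rewrite !natrM /= => e.
rewrite !mulrA e; have : (k.+1 - j)%:R != 0 :> rat by rewrite pnatr_eq0; lia.
by move=> ?; field.
Qed.

(** * Localization at the primes dividing n *)

(* Membership in Z_(n); without 0 < d, every r would qualify for n = 1. *)
Definition local_int (n : nat) (r : rat) : Prop :=
  exists2 d : nat, (0 < d)%N && coprime n d & d%:R * r \is a Num.int.

Lemma local_int_int n r : r \is a Num.int -> local_int n r.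
Proof. by exists 1%N; rewrite ?coprimen1 ?mul1r. Qed.

Lemma local_intD n r s : local_int n r -> local_int n s -> local_int n (r + s).
Proof.
move=> [d /andP[d0 nd] dr] [e /andP[e0 ne] es].
exists (d * e)%N; first by rewrite muln_gt0 d0 e0 coprimeMr nd.
have -> : (d * e)%:R * (r + s) = e%:R * (d%:R * r) + d%:R * (e%:R * s).
  by rewrite natrM; ring.
by rewrite rpredD // rpredM // rpred_nat.
Qed.

Lemma local_intM n r s : local_int n r -> local_int n s -> local_int n (r * s).
Proof.
move=> [d /andP[d0 nd] dr] [e /andP[e0 ne] es].
exists (d * e)%N; first by rewrite muln_gt0 d0 e0 coprimeMr nd.
have -> : (d * e)%:R * (r * s) = (d%:R * r) * (e%:R * s) by rewrite natrM; ring.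
by rewrite rpredM.
Qed.

Lemma local_intN n r : local_int n r -> local_int n (- r).
Proof. by case=> d d_n dr; exists d; rewrite ?mulrN ?rpredN. Qed.

Lemma local_int_sum n I (r : seq I) (P : pred I) F :
  (forall i, P i -> local_int n (F i)) -> local_int n (\sum_(i <- r | P i) F i).
Proof.
by move=> F_n; elim/big_ind: _ => //; [exact: local_int_int | exact: local_intD].
Qed.

(** If n divides the numerator of r - s, its denominator is coprime to n and serves as [d];
    conversely, Gauss's lemma cancels a [d] coprime to n. The right-hand side is closed under
    addition, which yields transitivity. *)
Lemma rat_congrP n r s : (0 < n)%N ->
  rat_congr n r s <-> local_int n ((r - s) / n%:R).
Proof.
move=> n_gt0; rewrite /rat_congr; set x := r - s.
have n0 : n%:R != 0 :> rat by rewrite pnatr_eq0 -lt0n.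
split=> [n_x | [d /andP[d0 nd] /intrP[z dz]]].
  have denx : `|denq x|%N%:R = (denq x)%:~R :> rat by rewrite pmulrn absz_denq.
  exists `|denq x|%N.
    rewrite absz_gt0 denq_neq0 /=; apply: coprime_dvdl (coprime_num_den x).
    by move: n_x; rewrite dvdzE.
  rewrite denx mulrA mulrC; have -> : (denq x)%:~R * x = (numq x)%:~R.
    by rewrite numqE mulrC.
  by rewrite mulrC; apply: (@Qint_dvdz (numq x) n%:Z).
have {dz} : d%:~R * x = (z * n)%:~R.
  by rewrite intrM -[z%:~R]dz -mulrA -!pmulrn divfK.
move/(congr1 (fun y => y * (denq x)%:~R)); rewrite -mulrA -numqE -!intrM.
move/intr_inj => e.
have : (n %| d%:Z * numq x)%Z by rewrite e dvdz_mulr // dvdz_mull.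
by rewrite Gauss_dvdzr.
Qed.

Lemma rat_congr_trans n r s t : (0 < n)%N ->
  rat_congr n r s -> rat_congr n s t -> rat_congr n r t.
Proof.
move=> n_gt0 /(rat_congrP _ _ n_gt0) rs /(rat_congrP _ _ n_gt0) st.
apply/(rat_congrP _ _ n_gt0).
have -> : (r - t) / n%:R = (r - s) / n%:R + (s - t) / n%:R by rewrite -mulrDl addrA subrK.
exact: local_intD.
Qed.

Lemma rat_congr_sym n r s : rat_congr n r s -> rat_congr n s r.
Proof. by rewrite /rat_congr -opprB numqN !dvdzE abszN. Qed.

Lemma rat_congr_nat n a b : rat_congr n a%:R b%:R <-> a = b %[mod n].
Proof.
have -> : rat_congr n a%:R b%:R <-> (n %| a%:Z - b%:Z)%Z.
  by rewrite /rat_congr !pmulrn -rmorphB numq_int.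
by rewrite -eqz_mod_dvd !modz_nat; split=> [/eqP[] | ->].
Qed.

(** * Denominators of Bernoulli numbers, and power sums modulo n *)

(** If p | n and p^l | m+1, then 2^l <= m+1 < 2^(a+1), so l <= a and p^l | n^a. Only the part [d] of
    m+1 prime to n can remain as denominator. *)
Lemma local_int_expr_div n m a : (0 < n)%N -> (m.+1 < 2 ^ a.+1)%N ->
  local_int n (n%:R ^+ a / m.+1%:R).
Proof.
move=> n_gt0 lt_ma; set d := ((m.+1)`_(\pi(n)^'))%N.
exists d.
  by rewrite part_gt0 (pnat_coprime (pnat_pi n_gt0) (part_pnat _ _)).
have /dvdnP[q nq] : (m.+1 %| d * n ^ a)%N.
  rewrite -(partnC \pi(n) (ltn0Sn m)) mulnC dvdn_pmul2l ?part_gt0 //.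
  apply/dvdn_partP => [|p]; first exact: part_gt0.
  rewrite /= pi_of_part // inE /= => /andP[_].
  rewrite inE mem_primes_gt0 // => /andP[p_pr p_n].
  rewrite p_part; apply: dvdn_trans (dvdn_exp2r _ p_n); rewrite dvdn_exp2l //.
  apply: leq_trans (_ : (logn p m.+1 <= a)%N).
    by rewrite dvdn_leq_log // dvdn_part.
  rewrite leqNgt; apply/negP => lt_al.
  suff : (2 ^ a.+1 <= m.+1)%N by rewrite leqNgt lt_ma.
  apply: leq_trans (_ : p ^ logn p m.+1 <= _)%N; last by rewrite dvdn_leq // pfactor_dvdnn.
  by apply: leq_trans (leq_pexp2l (prime_gt0 p_pr) lt_al); rewrite leq_exp2r // prime_gt1.
by rewrite mulrA -natrX -natrM nq natrM mulfK ?pnatr_eq0.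
Qed.

(** Strong induction on k: Faulhaber's formula writes n B_k as an integer minus terms C(k, j) (n
    B_j) n^(k-j) / (k-j+1), and k-j+1 < 2^(k-j+1). *)
Lemma local_int_bernoulli n k : (0 < n)%N -> local_int n (n%:R * bernoulli_minus k).
Proof.
move=> n_gt0; elim/ltn_ind: k => k IHk.
have := sum_powers_bernoulli k n; rewrite big_ord_recr /= binn subSnn mul1r divr1 expr1.
rewrite mulrC addrC => /esym/(canRL (addrK _))->.
apply: local_intD; first by apply/local_int_int/rpred_sum => i _; rewrite rpredX ?rpred_nat.
apply/local_intN/local_int_sum => j _.
have -> : (k.+1 - j = (k - j).+1)%N by have := ltn_ord j; lia.
rewrite exprS -[_ * _ / _]mulrA; set y := _ / _.
have -> : 'C(k, j)%:R * bernoulli_minus j * (n%:R * y) = 'C(k, j)%:R * ((n%:R * bernoulli_minus j) * y).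
  by ring.
apply: local_intM; first exact/local_int_int/rpred_nat.
apply: local_intM; first exact: IHk.
by apply: local_int_expr_div; rewrite // expnS; have := ltn_expl (k - j) (ltnSn 1); lia.
Qed.

Lemma sum_powers_congr_bernoulli n k : (0 < n)%N -> (0 < k)%N -> ~~ odd k ->
  rat_congr n (\sum_(1 <= i < n) i ^ k)%N%:R (n%:R * bernoulli_minus k).
Proof.
case: k => [|k] // n_gt0 _ k_even.
apply/(rat_congrP _ _ n_gt0).
have -> : (\sum_(1 <= i < n) i ^ k.+1)%N%:R = \sum_(0 <= i < n) i%:R ^+ k.+1 :> rat.
  rewrite [RHS]big_ltn // expr0n add0r natr_sum; apply: eq_bigr => i _.
  by rewrite natrX.
rewrite sum_powers_bernoulli big_ord_recr /= binn subSnn mul1r divr1 expr1.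
rewrite [_ * n%:R]mulrC addrK mulr_suml; apply: local_int_sum => j _.
have n0 : n%:R != 0 :> rat by rewrite pnatr_eq0 -lt0n.
have [lt_jk | le_kj] := ltnP j k; last first.
  (* The term j = k is (k+1)/2 * n^2 B_k, integral because k + 1 is even. *)
  have -> : nat_of_ord j = k by have := ltn_ord j; lia.
  have -> : (k.+2 - k = 2)%N by lia.
  rewrite binSn -(even_halfK k_even) -muln2 natrM.
  have -> : forall h b : rat, h * 2 * b * (n%:R ^+ 2 / 2) / n%:R = h * (n%:R * b).
    by move=> h b; field; rewrite ?n0.
  apply: local_intM; last exact: local_int_bernoulli.
  exact/local_int_int/rpred_nat.
have -> : (k.+2 - j = (k - j).+2)%N by lia.
rewrite 2!exprS.
have -> : forall b c x y : rat, c * b * (n%:R * (n%:R * x) * y) / n%:R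
    = c * ((n%:R * b) * (x * y)) by move=> b c x y; field.
apply: local_intM; first exact/local_int_int/rpred_nat.
apply: local_intM; first exact: local_int_bernoulli.
apply: local_int_expr_div => //.
(* The bound k-j+2 < 2^(k-j+1) holds because j < k; it fails at j = k. *)
have [m ->] : exists m, (k - j = m.+1)%N by exists (k - j).-1; lia.
by rewrite !expnS; have := ltn_expl m (ltnSn 1); lia.
Qed.

(** * Totients and squarefree divisibility *)

Lemma totient_dvd_prime n p : (0 < n)%N -> prime p -> (p %| n)%N ->
  (p.-1 %| totient n)%N.
Proof.
move=> n_gt0 p_pr p_n; rewrite totientE // (bigD1_seq p) ?primes_uniq //=.
  by rewrite -mulnA dvdn_mulr.
by rewrite mem_primes_gt0 ?p_pr.
Qed.

(** An odd prime p | n gives the even divisor p - 1 of phi(n); otherwise n = 2^l with l >= 2. *)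
Lemma totient_even n : (2 < n)%N -> ~~ odd (totient n).
Proof.
move=> n_gt2; have n_gt0 : (0 < n)%N by lia.
have even_dvd m : (m %| totient n)%N -> ~~ odd m -> ~~ odd (totient n).
  by rewrite -!dvdn2 => m_n even_m; apply: dvdn_trans m_n.
have [/allP two | /allPn[p]] := boolP (all (pred1 2%N) (primes n)); last first.
  rewrite mem_primes_gt0 // => /andP[p_pr p_n] /= p_neq2.
  apply: even_dvd (totient_dvd_prime n_gt0 p_pr p_n) _.
  by case/even_prime: p_pr p_neq2 => [-> //|]; lia.
have n2 : (n = 2 ^ logn 2 n)%N.
  rewrite -p_part part_pnat_id //; apply/pnatP => // p p_pr p_n.
  by have /two : p \in primes n by rewrite mem_primes_gt0 ?p_pr.
move: n_gt2; rewrite n2; case: (logn 2 n) => [|[|l]] // _.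
by rewrite totient_pfactor // expnS mul1n oddM.
Qed.

Lemma dvdn_cofactorF n p : (0 < n)%N -> prime p -> (p %| n)%N ->
  ~~ (p %| n %/ p)%N -> logn p n = 1%N.
Proof.
move=> n_gt0 p_pr p_n; rewrite dvdn_divRL // mulnn pfactor_dvdn //.
have : (0 < logn p n)%N by rewrite logn_gt0 mem_primes_gt0 ?p_pr.
by lia.
Qed.

Lemma dvdn_squarefree n x : (0 < n)%N ->
  (forall p, prime p -> p %| n -> ~~ (p %| n %/ p))%N ->
  (forall p, prime p -> p %| n -> p %| x)%N -> (n %| x)%N.
Proof.
move=> n_gt0 n_sqf n_x; apply/dvdn_partP => // p.
rewrite inE mem_primes_gt0 // => /andP[p_pr p_n].
by rewrite p_part (dvdn_cofactorF n_gt0 p_pr p_n) ?n_sqf //; apply: n_x.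
Qed.

(** * Reduction of cofactor sums to condition (v) *)

Definition weak_primary_pseudoperfect (n : nat) : Prop :=
  (forall p : nat, prime p -> p %| n -> p %| n %/ p + 1)%N.

Lemma weak_primary_pseudoperfect_cofactor n p : weak_primary_pseudoperfect n -> prime p -> (p %| n)%N ->
  ~~ (p %| n %/ p)%N.
Proof.
move=> n_wpp p_pr p_n; apply/negP => p_np.
have := n_wpp p p_pr p_n; rewrite dvdn_addr // dvdn1 => /eqP p1.
by rewrite p1 in p_pr.
Qed.

Lemma dvdn_sum_cofactors n p (c : nat -> nat) : prime p -> (0 < n)%N -> (p %| n)%N ->
  (p %| \sum_(q <- primes n) c q * (n %/ q) + 1)%N = (p %| c p * (n %/ p) + 1)%N.
Proof.
move=> p_pr n_gt0 p_n.
rewrite (bigD1_seq p) ?primes_uniq ?mem_primes_gt0 ?p_pr //= addnAC dvdn_addl //.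
rewrite big_seq_cond; elim/big_ind: _ => [|x y|q]; [exact: dvdn0 | exact: dvdn_add |].
rewrite mem_primes_gt0 // => /andP[/andP[q_pr q_n] q_neq_p].
rewrite dvdn_mull //; move: p_n; rewrite -{1}(divnK q_n) Gauss_dvdl //.
by rewrite prime_coprime // dvdn_prime2 // eq_sym.
Qed.

(** Weight 1 serves (i) and (ii), weight [logn p n] serves (vi). Either side forces p not to divide
    n/p, so only weights at exponent 1 matter. *)
Lemma weak_primary_pseudoperfect_sum n (c : nat -> nat) : (0 < n)%N ->
  (forall p, logn p n = 1 -> c p = 1)%N ->
  (n %| \sum_(p <- primes n) c p * (n %/ p) + 1)%N <-> weak_primary_pseudoperfect n.
Proof.
move=> n_gt0 c1; split=> [n_sum p p_pr p_n | n_wpp].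
  have := dvdn_trans p_n n_sum; rewrite dvdn_sum_cofactors // => p_cnp.
  suff /c1 cp1 : logn p n = 1%N by rewrite cp1 mul1n in p_cnp.
  apply: dvdn_cofactorF => //; apply/negP => p_np.
  move: p_cnp; rewrite dvdn_addr ?dvdn_mull // dvdn1 => /eqP p1.
  by rewrite p1 in p_pr.
apply: dvdn_squarefree => // [p|p p_pr p_n]; first exact: weak_primary_pseudoperfect_cofactor.
rewrite dvdn_sum_cofactors // c1 ?mul1n; first exact: n_wpp.
by apply: dvdn_cofactorF => //; apply: weak_primary_pseudoperfect_cofactor.
Qed.

(** * Power sums with exponent phi(n) *)

(** The indicator of p | i makes Fermat's theorem uniform in i: summed over 1 <= i <= n, the right
    side gives n, and the indicators count n/p. *)
Lemma expn_totient_dvd n p i : prime p -> (0 < n)%N -> (p %| n)%N ->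
  (i ^ totient n + (p %| i) = 1 %[mod p])%N.
Proof.
move=> p_pr n_gt0 p_n; have [p_i | p_i] := boolP (p %| i)%N.
  have /eqP : (p %| i ^ totient n)%N by rewrite dvdn_exp // totient_gt0.
  by rewrite -modnDml => ->.
rewrite addn0; have /dvdnP[k ->] := totient_dvd_prime n_gt0 p_pr p_n.
have /eqP : i ^ p = i %[mod p] by exact: fermat_little.
have i_gt0 : (0 < i)%N by case: i p_i; rewrite ?dvdn0.
rewrite -{1}(prednK (prime_gt0 p_pr)) expnS -{3}[i]muln1 eqn_mod_dvd; last first.
  by rewrite leq_pmul2l // expn_gt0 i_gt0.
rewrite -mulnBr Gauss_dvdr ?prime_coprime // -eqn_mod_dvd ?expn_gt0 ?i_gt0 //.
by move=> /eqP Fermat; rewrite mulnC expnM -modnXm Fermat modnXm exp1n.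
Qed.

Lemma sum_expn_totient n p : prime p -> (0 < n)%N -> (p %| n)%N ->
  (p %| \sum_(1 <= i < n) i ^ totient n + n %/ p)%N.
Proof.
move=> p_pr n_gt0 p_n.
have : (p %| \sum_(1 <= i < n.+1) (i ^ totient n + (p %| i)))%N.
  rewrite /dvdn -modn_summ.
  under eq_bigr => i _ do rewrite expn_totient_dvd //.
  by rewrite modn_summ sum_nat_const_nat subn1 muln1.
rewrite big_split /= -divn_count_dvd big_nat_recr //= addnAC dvdn_addl //.
by rewrite dvdn_exp // totient_gt0.
Qed.

Lemma weak_primary_pseudoperfect_sum_expn n : (0 < n)%N ->
  (\sum_(1 <= i < n) i ^ totient n = 1 %[mod n])%N <-> weak_primary_pseudoperfect n.
Proof.
move=> n_gt0; split=> [S1 p p_pr p_n | n_wpp].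
  have S1p : (\sum_(1 <= i < n) i ^ totient n = 1 %[mod p])%N.
    by rewrite -(modn_dvdm _ p_n) S1 modn_dvdm.
  have := sum_expn_totient p_pr n_gt0 p_n.
  by rewrite /dvdn -modnDml S1p modnDml addnC.
have [n_gt1 | ] := ltnP 1 n; last by case: (n) n_gt0 => [|[|]] // _ _; rewrite !modn1.
have S_gt0 : (0 < \sum_(1 <= i < n) i ^ totient n)%N by rewrite big_ltn // exp1n.
apply/eqP; rewrite eqn_mod_dvd //.
apply: dvdn_squarefree => // [p|p p_pr p_n]; first exact: weak_primary_pseudoperfect_cofactor.
(* Adding n/p + 1 to S - 1, where S is the power sum, gives S + n/p. *)
rewrite -(dvdn_addl _ (n_wpp p p_pr p_n)) addnA addnAC subnK //.
exact: sum_expn_totient.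
Qed.

(** * The Bernoulli congruence and the cycle of implications *)

Lemma rat_congr_bernoulli n B : (0 < n)%N -> is_bernoulli B ->
  rat_congr n (n%:R * B (totient n)) 1 <->
  (\sum_(1 <= i < n) i ^ totient n = 1 %[mod n])%N.
Proof.
move=> n_gt0 HB; have [n_gt2 | n_le2] := ltnP 2 n; last first.
  (* For n <= 2 the exponent phi(n) = 1 is odd: modulo 1 all is trivial, and for n = 2 both
     conventions give 2 B_1 = 1 or -1, congruent to 1. *)
  have /orP[] : (n == 1) || (n == 2)%N by lia.
    by move/eqP->; rewrite !modn1 /rat_congr dvd1z.
  move/eqP->; rewrite big_nat1 exp1n; split=> // _.
  have [B1 B1'] := bernoulli1.
  by case: HB => ->; rewrite ?B1 ?B1'.
have e_even := totient_even n_gt2.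
have -> : B (totient n) = bernoulli_minus (totient n).
  case: HB => -> //; by rewrite /bernoulli_plus -signr_odd (negPf e_even) mul1r.
have S_nB : rat_congr n (\sum_(1 <= i < n) i ^ totient n)%N%:R
    (n%:R * bernoulli_minus (totient n)).
  by apply: sum_powers_congr_bernoulli; rewrite ?totient_gt0.
rewrite -rat_congr_nat; split; apply: rat_congr_trans => //.
exact: rat_congr_sym.
Qed.

Lemma natr_sum_cofactors n (c : nat -> nat) : (0 < n)%N ->
  (\sum_(p <- primes n) c p * (n %/ p))%N%:R
  = n%:R * \sum_(p <- primes n) (c p)%:R / p%:R :> rat.
Proof.
move=> n_gt0; rewrite natr_sum mulr_sumr [LHS]big_seq [RHS]big_seq.
apply: eq_bigr => p; rewrite mem_primes_gt0 // => /andP[p_pr p_n].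
rewrite -{2}(divnK p_n) !natrM; have : p%:R != 0 :> rat.
  by rewrite pnatr_eq0 -lt0n prime_gt0.
by move=> ?; field.
Qed.

Theorem theorem1 (n : nat) (B : nat -> rat) (n_gt0 : (0 < n)%N)
    (HB : is_bernoulli B) :
  [<-> (* (i) *)
       exists m : nat, (0 < m)%N /\
         (n%:R^-1 + \sum_(p <- primes n) p%:R^-1 = m%:R :> rat);
       (* (ii) *)
       ((\sum_(p <- primes n) n %/ p) + 1 = 0 %[mod n])%N;
       (* (iii) *)
       rat_congr n (n%:R * B (totient n)) 1;
       (* (iv) *)
       (\sum_(1 <= i < n) i ^ totient n = 1 %[mod n])%N;
       (* (v) *)
       (forall p : nat, prime p -> p %| n -> p %| n %/ p + 1)%N;
       (* (vi) *)
       exists a : nat, (0 < a)%N /\ arith_deriv n = a%:R * n%:R - 1].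
Proof.
have n0 : n%:R != 0 :> rat by rewrite pnatr_eq0 -lt0n.
have sum1 : (\sum_(p <- primes n) n %/ p = \sum_(p <- primes n) 1 * (n %/ p))%N.
  by apply: eq_bigr => p _; rewrite mul1n.
have cofactor_sum : n%:R * (n%:R^-1 + \sum_(p <- primes n) p%:R^-1)
    = ((\sum_(p <- primes n) n %/ p) + 1)%N%:R :> rat.
  rewrite natrD sum1 (natr_sum_cofactors (fun=> 1%N)) // mulrDr divff // addrC.
  by under [in RHS]eq_bigr => p _ do rewrite mul1r.
have iiP : ((\sum_(p <- primes n) n %/ p) + 1 = 0 %[mod n])%N <-> weak_primary_pseudoperfect n.
  rewrite -(@weak_primary_pseudoperfect_sum n (fun=> 1%N)) // -sum1 /dvdn mod0n.
  by split=> [/eqP | /eqP].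
have vP : (exists a : nat, (0 < a)%N /\ arith_deriv n = a%:R * n%:R - 1)
    <-> weak_primary_pseudoperfect n.
  rewrite -(@weak_primary_pseudoperfect_sum n (logn^~ n)) // /arith_deriv -natr_sum_cofactors //.
  split=> [[a [_ /eqP]] | /dvdnP[a na]].
    by rewrite eq_sym subr_eq natr1 -natrM eqr_nat => /eqP; rewrite -addn1 => <-; apply: dvdn_mull.
  exists a; split; last by rewrite -natrM -na natrD addrK.
  (* The value a = 0 would make a sum of the form s + 1 vanish. *)
  by case: a na => //; rewrite mul0n addn1.
tfae.
- case=> m [_ nm]; move: cofactor_sum; rewrite nm -natrM => /eqP.
  by rewrite eqr_nat => /eqP <-; rewrite modnMr mod0n.
(* From (ii) to (iii) by way of (v) and (iv). *)
- by move/iiP/(weak_primary_pseudoperfect_sum_expn n_gt0)/(rat_congr_bernoulli n_gt0 HB).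
- by move/(rat_congr_bernoulli n_gt0 HB).
- by move/(weak_primary_pseudoperfect_sum_expn n_gt0).
- by move/vP.
(* From (vi) through (v) to (ii), whose quotient by n is the integer in (i). *)
- move/vP/iiP/eqP; rewrite mod0n => /dvdnP[m nm].
  exists m; split; first by case: m nm => //; rewrite mul0n addn1.
  by apply: (mulfI n0); rewrite cofactor_sum nm natrM mulrC.
Qed.
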